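(* Let $\mathcal{C}$ be an $[n,k]$ MDS code over a field $\mathbb{K}$, let $R=\mathbb{K}[x_1,\ldots,x_k]$, and let $\ell\in\Sigma_{\mathcal{C}}$. Let $\mathcal{C}'$ and $\mathcal{C}''$ be the deletion and restriction of $\mathcal{C}$ at $\ell$, respectively. Then one has a short exact sequence of $R$-modules $$0\longrightarrow \mathrm{Fitt}(\mathcal{C}')(-1)\xrightarrow{\ \cdot \ell\ }\mathrm{Fitt}(\mathcal{C})\longrightarrow \mathrm{Fitt}(\mathcal{C}'')\longrightarrow 0.$$
   Context: An $[n,k,d]$-linear code $\mathcal{C}$ over a field $\mathbb{K}$ is the image of an injective linear map $\mathbb{K}^k\to\mathbb{K}^n$, $\mathbf{x}\mapsto \mathbf{x}G$, where $G=(a_{ij})$ is a $k\times n$ matrix of rank $k\ge 1$ (a generating matrix); $d$ is the smallest number of nonzero entries in a nonzero element of $\mathcal{C}$. The code is MDS if $d=n-k+1$. $\Sigma_{\mathcal{C}}=(\ell_1,\ldots,\ell_n)$ is the collection of linear forms dual to the columns of $G$, $\ell_j=\sum_{i=1}^k a_{ij}x_i$. Deletion and restriction. Let $\ell=\ell_i$. The deletion (puncturing) $\mathcal{C}'$ at $\ell$ is given by removing the $i$-th column of $G$, i.e. its collection of linear forms is $\Sigma_{\mathcal{C}'}=(\ell_j)_{j\neq i}$ in the same ring $R$. For the restriction (shortening) $\mathcal{C}''$ at $\ell$: do row operations on $G$ (a linear change of coordinates) so that the $i$-th column becomes $(0,\ldots,0,1)^T$, i.e. $\ell=x_k$, and then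 delete the last row and the $i$-th column. Equivalently, $\Sigma_{\mathcal{C}''}$ is the collection of $n-1$ images of the $\ell_j$, $j\ne i$, in $R''=R/\langle \ell\rangle\cong\mathbb{K}[x_1,\ldots,x_{k-1}]$. Fitting modules. For a collection $\Sigma=(\ell_1,\ldots,\ell_N)$ of linear forms in a polynomial ring $A$ and $1\le j\le N$, let $I(\Sigma,j)\subset A$ be the ideal generated by all products $\ell_{i_1}\cdots\ell_{i_j}$ with $1\le i_1<\cdots<i_j\le N$; set $I(\Sigma,0)=A$ and $I(\Sigma,N+1)=0$. The Fitting module is $\mathrm{Fitt}=\bigoplus_{j=0}^{N}I(\Sigma,j)/I(\Sigma,j+1)$ (it is built from the Fitting ideals of $\bigoplus_i A/\langle \ell_i\rangle=\mathrm{coker}\,\mathrm{diag}(\ell_1,\ldots,\ell_N)$). $\mathrm{Fitt}(\mathcal{C})$ uses $A=R$, $\Sigma=\Sigma_{\mathcal{C}}$, $N=n$; $\mathrm{Fitt}(\mathcal{C}')$ uses $A=R$, $\Sigma=\Sigma_{\mathcal{C}'}$, $N=n-1$; $\mathrm{Fitt}(\mathcal{C}'')$ uses $A=R''$, $\Sigma=\Sigma_{\mathcal{C}''}$, $N=n-1$, and is an $R$-module via $R\to R''$. Each summand has the grading induced from the polynomial ring, and direct sums are graded componentwise; $M(-1)$ denotes the graded shift $M(-1)_t=M_{t-1}$. The map $\cdot\ell$ is multiplication by $\ell$, sending the summand $I(\Sigma_{\mathcal{C}'},j-1)/I(\Sigma_{\mathcal{C}'},j)$ to the summand $I(\Sigma_{\mathcal{C}},j)/I(\Sigma_{\mathcal{C}},j+1)$.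 *)

(* Defs.v *)
From HB Require Import structures.
From mathcomp Require Import all_boot all_order all_algebra.
From mathcomp Require Import boolp mpoly.

Set Implicit Arguments.
Unset Strict Implicit.
Unset Printing Implicit Defensive.

Import GRing.Theory.
Local Open Scope ring_scope.
Local Open Scope quotient_scope.

Section Submodule.
Variables (R : comNzRingType) (V : lmodType R) (U : submodClosed V).

Record submod := Submod { submod_val : V; _ : submod_val \in U }.

HB.instance Definition _ := [isSub for submod_val].
HB.instance Definition _ := [Choice of submod by <:].
HB.instance Definition _ := [SubChoice_isSubLmodule of submod by <:].

End Submodule.

Section QuotientModule.
Variables (R : comNzRingType) (V : lmodType R) (W : submodClosed V).

Definition zmod_of_submod : zmodClosed V :=
  HB.pack (fun v : V => v \in W) (GRing.isZmodClosed.Build V (fun v => v \in W)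
    (GRing.submod_closedB (GRing.submodClosedP W))).

Definition quotmod : Type := Quotient.quot zmod_of_submod.
HB.instance Definition _ := GRing.Zmodule.on quotmod.

Definition quotmod_class (v : V) : quotmod := \pi_(Quotient.quot zmod_of_submod) v.

Lemma quotmod_classE (u v : V) :
  (quotmod_class u = quotmod_class v) <-> (u - v \in W).
Proof.
rewrite /quotmod_class; split=> [|uvW].
  by move/eqP; rewrite -Quotient.idealrBE.
by apply/eqP; rewrite -Quotient.idealrBE.
Qed.

Lemma quotmod_surj (x : quotmod) : exists v, x = quotmod_class v.
Proof. by exists (repr x); rewrite /quotmod_class reprK. Qed.

Lemma quotmod_classD : {morph quotmod_class : u v / u + v}.
Proof. by move=> u v; rewrite /quotmod_class raddfD. Qed.

Definition quotmod_scale (a : R) (x : quotmod) : quotmod :=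
  quotmod_class (a *: repr x).

Lemma quotmod_scaleE a v :
  quotmod_scale a (quotmod_class v) = quotmod_class (a *: v).
Proof.
apply/quotmod_classE; rewrite -scalerBr rpredZ //.
by apply/quotmod_classE; rewrite /quotmod_class reprK.
Qed.

Fact quotmod_scaleA a b x :
  quotmod_scale a (quotmod_scale b x) = quotmod_scale (a * b) x.
Proof. by have [v ->] := quotmod_surj x; rewrite !quotmod_scaleE scalerA. Qed.

Fact quotmod_scale1 : left_id 1 quotmod_scale.
Proof.
by move=> x; have [v ->] := quotmod_surj x; rewrite quotmod_scaleE scale1r.
Qed.

Fact quotmod_scaleDr : right_distributive quotmod_scale +%R.
Proof.
move=> a x y; have [u ->] := quotmod_surj x; have [v ->] := quotmod_surj y.
by rewrite -quotmod_classD !quotmod_scaleE -quotmod_classD scalerDr.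
Qed.

Fact quotmod_scaleDl x : {morph quotmod_scale^~ x : a b / a + b}.
Proof.
move=> a b; have [v ->] := quotmod_surj x.
by rewrite !quotmod_scaleE -quotmod_classD scalerDl.
Qed.

HB.instance Definition _ := GRing.Zmodule_isLmodule.Build R quotmod
  quotmod_scaleA quotmod_scale1 quotmod_scaleDr quotmod_scaleDl.

Lemma quotmod_class_is_linear : linear quotmod_class.
Proof. by move=> a u v; rewrite quotmod_classD -quotmod_scaleE. Qed.

HB.instance Definition _ :=
  GRing.isLinear.Build R V quotmod _ quotmod_class quotmod_class_is_linear.

End QuotientModule.

Section Subquotient.
Variables (R : comNzRingType) (V : lmodType R) (U W : submodClosed V).

Definition in_submod : {pred submod U} := fun u => \val u \in W.

Fact in_submod_closed : submod_closed in_submod.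
Proof.
split=> [|a u v uW vW]; first by rewrite unfold_in raddf0 rpred0.
by rewrite unfold_in linearP rpredD ?rpredZ.
Qed.

HB.instance Definition _ :=
  GRing.isSubmodClosed.Build R (submod U) in_submod in_submod_closed.

(** [U / (U :&: W)], which is [U / W] when [W] is contained in [U]. *)
Definition subquot : Type := quotmod in_submod.
HB.instance Definition _ := GRing.Lmodule.on subquot.

Definition subquot_class (u : submod U) : subquot := quotmod_class in_submod u.
HB.instance Definition _ := GRing.isLinear.Build R (submod U) subquot _
  subquot_class (@quotmod_class_is_linear R (submod U) in_submod).

Lemma subquot_classE (u v : submod U) :
  (subquot_class u = subquot_class v) <-> (\val u - \val v \in W).
Proof. by rewrite -raddfB; apply: quotmod_classE. Qed.

Lemma subquot_surj (x : subquot) : exists u, x = subquot_class u.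
Proof. exact: quotmod_surj. Qed.

End Subquotient.

(** The map [U / W -> U' / W'] induced by [f]; the default value given to
    [insubd] is not used when [f] maps [U] into [U'], see [subquot_mapE]. *)
Definition subquot_map (R R' : comNzRingType) (V : lmodType R)
    (V' : lmodType R') (U W : submodClosed V) (U' W' : submodClosed V')
    (f : V -> V') (x : subquot U W) : subquot U' W' :=
  subquot_class W' (insubd (0 : submod U') (f (\val (repr x)))).

Section SubquotientMap.
Variables (R R' : comNzRingType) (V : lmodType R) (V' : lmodType R').
Variables (U W : submodClosed V) (U' W' : submodClosed V') (f : V -> V').
Hypothesis fB : {morph f : x y / x - y}.
Hypothesis fU : forall x, x \in U -> f x \in U'.
Hypothesis fW : forall x, x \in W -> f x \in W'.

Lemma subquot_mapE (u : submod U) (v : submod U') : \val v = f (\val u) ->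
  subquot_map U' W' f (subquot_class W u) = subquot_class W' v.
Proof.
move=> vE; apply/subquot_classE.
rewrite insubdK; last by apply: fU; exact: valP.
rewrite vE -fB; apply: fW.
by apply/(subquot_classE W); rewrite /subquot_class /quotmod_class reprK.
Qed.

Lemma subquot_map_semilinear (phi : R -> R') :
  (forall a x, f (a *: x) = phi a *: f x) ->
  forall a (x y : subquot U W),
    subquot_map U' W' f (a *: x + y)
    = phi a *: subquot_map U' W' f x + subquot_map U' W' f y.
Proof.
move=> fZ a x y; have [u ->] := subquot_surj x; have [v ->] := subquot_surj y.
have fD p q : f (p + q) = f p + f q.
  by have := fB (p + q) q; rewrite addrK => ->; rewrite subrK.
pose im (w : submod U) : submod U' := Submod (fU (valP w)).
have imE w : subquot_map U' W' f (subquot_class W w) = subquot_class W' (im w).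
  exact: subquot_mapE.
rewrite -linearP !imE -linearP; congr (subquot_class _ _).
apply: val_inj; rewrite [RHS]linearP /= -fZ -fD; congr f; exact: (linearP \val).
Qed.

End SubquotientMap.

Section DirectSum.
Variables (R : comNzRingType) (I : finType) (M : I -> lmodType R).

Definition dirsum : Type := forall i, M i.
HB.instance Definition _ := Choice.copy dirsum (forall i, M i).

Implicit Types x y : dirsum.

Definition dirsum_zero : dirsum := fun=> 0.
Definition dirsum_opp x : dirsum := fun i => - x i.
Definition dirsum_add x y : dirsum := fun i => x i + y i.
Definition dirsum_scale (a : R) x : dirsum := fun i => a *: x i.

Fact dirsum_addA : associative dirsum_add.
Proof. by move=> x y z; apply: functional_extensionality_dep => i; exact: addrA. Qed.
Fact dirsum_addC : commutative dirsum_add.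
Proof. by move=> x y; apply: functional_extensionality_dep => i; exact: addrC. Qed.
Fact dirsum_add0 : left_id dirsum_zero dirsum_add.
Proof. by move=> x; apply: functional_extensionality_dep => i; exact: add0r. Qed.
Fact dirsum_addN : left_inverse dirsum_zero dirsum_opp dirsum_add.
Proof. by move=> x; apply: functional_extensionality_dep => i; exact: addNr. Qed.

HB.instance Definition _ := GRing.isZmodule.Build dirsum
  dirsum_addA dirsum_addC dirsum_add0 dirsum_addN.

Fact dirsum_scaleA a b x :
  dirsum_scale a (dirsum_scale b x) = dirsum_scale (a * b) x.
Proof. by apply: functional_extensionality_dep => i; exact: scalerA. Qed.
Fact dirsum_scale1 : left_id 1 dirsum_scale.
Proof. by move=> x; apply: functional_extensionality_dep => i; exact: scale1r. Qed.
Fact dirsum_scaleDr : right_distributive dirsum_scale +%R.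
Proof. by move=> a x y; apply: functional_extensionality_dep => i; exact: scalerDr. Qed.
Fact dirsum_scaleDl x : {morph dirsum_scale^~ x : a b / a + b}.
Proof. by move=> a b; apply: functional_extensionality_dep => i; exact: scalerDl. Qed.

HB.instance Definition _ := GRing.Zmodule_isLmodule.Build R dirsum
  dirsum_scaleA dirsum_scale1 dirsum_scaleDr dirsum_scaleDl.

End DirectSum.

Section RestrictionOfScalars.
Variables (R S : comNzRingType) (phi : {rmorphism R -> S}) (M : lmodType S).

Definition res_scalars of phantom (R -> S) phi : Type := M.
Local Notation resM := (res_scalars (Phantom (R -> S) phi)).
HB.instance Definition _ := GRing.Zmodule.copy resM M.

Definition res_scale (a : R) (x : resM) : resM := phi a *: (x : M).

Fact res_scaleA a b x : res_scale a (res_scale b x) = res_scale (a * b) x.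
Proof. by rewrite /res_scale scalerA rmorphM. Qed.
Fact res_scale1 : left_id 1 res_scale.
Proof. by move=> x; rewrite /res_scale rmorph1 scale1r. Qed.
Fact res_scaleDr : right_distributive res_scale +%R.
Proof. by move=> a x y; rewrite /res_scale scalerDr. Qed.
Fact res_scaleDl x : {morph res_scale^~ x : a b / a + b}.
Proof. by move=> a b; rewrite /res_scale rmorphD scalerDl. Qed.

HB.instance Definition _ := GRing.Zmodule_isLmodule.Build R resM
  res_scaleA res_scale1 res_scaleDr res_scaleDl.

End RestrictionOfScalars.

Notation restrict_scalars phi M := (@res_scalars _ _ phi M (Phantom _ _)).

Definition short_exact (R : comNzRingType) (M' M M'' : lmodType R)
    (f : {linear M' -> M}) (g : {linear M -> M''}) : Prop :=
  [/\ injective f,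
      forall x, g x = 0 <-> exists y, x = f y
    & forall z, exists x, z = g x].

(** A grading is given by its homogeneous pieces, indexed by [int]. *)
Definition shift (M : Type) (a : int) (piece : int -> M -> Prop) :=
  fun t => piece (t + a).

Definition graded_map (M N : Type) (pM : int -> M -> Prop)
    (pN : int -> N -> Prop) (f : M -> N) : Prop :=
  forall t x, pM t x -> pN t (f x).

Section Fitting.
Variables (A : comNzRingType) (N : nat) (Sigma : 'I_N -> A).

(** For [j = 0] this is [A] and for [j = N.+1] it is [0]. *)
Definition fitt_ideal (j : nat) : {pred A^o} := fun p : A =>
  `[< exists c : {set 'I_N} -> A,
        p = \sum_(S : {set 'I_N} | #|S| == j) c S * \prod_(i in S) Sigma i >].

Fact fitt_ideal_closed j : submod_closed (fitt_ideal j).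
Proof.
split=> [|a p q /asboolP[c ->] /asboolP[d ->]]; apply/asboolP.
  by exists (fun=> 0); rewrite big1 // => S _; rewrite mul0r.
exists (fun S => a * c S + d S).
rewrite [a *: _]mulr_sumr -big_split; apply: eq_bigr => S _ /=.
by rewrite mulrDl mulrA.
Qed.

HB.instance Definition _ j :=
  GRing.isSubmodClosed.Build A A^o (fitt_ideal j) (fitt_ideal_closed j).

Definition fitt_summand (j : nat) : lmodType A :=
  subquot (fitt_ideal j) (fitt_ideal j.+1).

Definition Fitt : lmodType A :=
  dirsum (fun j : 'I_N.+1 => fitt_summand j).

Lemma fitt_ideal_gen j (S : {set 'I_N}) (a : A) :
  #|S| = j -> a * \prod_(i in S) Sigma i \in fitt_ideal j.
Proof.
move=> Sj; apply/asboolP; exists (fun T => if T == S then a else 0).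
rewrite [RHS](bigD1 S) /=; last by rewrite Sj.
rewrite eqxx [X in _ + X]big1 ?addr0 // => T /andP[_ /negPf->].
by rewrite mul0r.
Qed.

Lemma fitt_ideal_sum j (I : Type) (r : seq I) (P : pred I) (F : I -> A) :
  (forall i, P i -> F i \in fitt_ideal j) ->
  \sum_(i <- r | P i) F i \in fitt_ideal j.
Proof. exact: (@rpred_sum A^o (fitt_ideal j)). Qed.

Lemma fitt_ideal_sub j (p : A) : p \in fitt_ideal j.+1 -> p \in fitt_ideal j.
Proof.
move=> /asboolP[c ->]; apply: fitt_ideal_sum => S /eqP Sj.
have /card_gt0P[i iS] : (0 < #|S|)%N by rewrite Sj.
rewrite (big_setD1 i) //= mulrA; apply: fitt_ideal_gen.
by apply/eqP; rewrite -eqSS -Sj (cardsD1 i S) iS.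
Qed.

Lemma fitt_ideal0 (p : A) : p \in fitt_ideal 0.
Proof. by have := @fitt_ideal_gen 0 set0 p (cards0 _); rewrite big_set0 mulr1. Qed.

Lemma fitt_idealS (p : A) : p \in fitt_ideal N.+1 <-> p = 0.
Proof.
split=> [/asboolP[c ->]|->]; last exact: rpred0.
by rewrite big1 // => S /eqP SN; have := max_card S; rewrite card_ord SN ltnn.
Qed.

End Fitting.

Definition fitt_summand_map (A B : comNzRingType) (N N' : nat)
    (Sigma : 'I_N -> A) (Sigma' : 'I_N' -> B) (j j' : nat) (f : A -> B) :
    fitt_summand Sigma j -> fitt_summand Sigma' j' :=
  @subquot_map A B A^o B^o (fitt_ideal Sigma j) (fitt_ideal Sigma j.+1)
    (fitt_ideal Sigma' j') (fitt_ideal Sigma' j'.+1) f.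

Section Codes.
Variable K : fieldType.

Definition hamming_weight n (c : 'rV[K]_n) : nat :=
  #|[set j : 'I_n | c 0 j != 0]|.

(** The code generated by [G] is the row space of [G]. *)
Definition is_min_distance k n (G : 'M[K]_(k, n)) (d : nat) : Prop :=
  (exists2 c : 'rV_n, (c <= G)%MS && (c != 0) & hamming_weight c = d) /\
  (forall c : 'rV_n, (c <= G)%MS -> c != 0 -> (d <= hamming_weight c)%N).

Definition MDS k n (G : 'M[K]_(k, n)) : Prop :=
  row_free G /\ is_min_distance G (n - k + 1).

Definition forms k n (G : 'M[K]_(k, n)) (j : 'I_n) : {mpoly K[k]} :=
  \sum_(r < k) G r j *: 'X_r.

Definition is_homogeneous k (t : int) (p : {mpoly K[k]}) : bool :=
  if t is Posz d then p \is d.-homog else p == 0.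

(** The degree [t] piece: in each summand, the classes of the homogeneous
    elements of degree [t] of the ideal. *)
Definition Fitt_piece k N (Sigma : 'I_N -> {mpoly K[k]}) (t : int)
    (x : Fitt Sigma) : Prop :=
  forall j : 'I_N.+1, exists2 p : submod (fitt_ideal Sigma j),
    is_homogeneous t (\val p) & x j = subquot_class _ p.

End Codes.

Definition deletion (K : fieldType) k n (G : 'M[K]_(k, n.+1)) (i : 'I_n.+1) :
    'M[K]_(k, n) :=
  col' i G.

(** Meant for a matrix [G] whose [i]-th column is [(0, ..., 0, 1)^T]. *)
Definition restriction (K : fieldType) k n (G : 'M[K]_(k.+1, n.+1))
    (i : 'I_n.+1) : 'M[K]_(k, n) :=
  row' ord_max (col' i G).

Section DeletionRestriction.
Variables (K : fieldType) (k n : nat).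
Variables (G : 'M[K]_(k.+1, n.+1)) (i : 'I_n.+1).

Lemma forms_deletion j : forms (deletion G i) j = forms G (lift i j).
Proof. by apply: eq_bigr => r _; rewrite mxE. Qed.

(** Multiplication by the [i]-th form, from summand [j] to summand [j + 1]. *)
Definition mul_form (x : Fitt (forms (deletion G i))) : Fitt (forms G) :=
  fun j : 'I_n.+2 =>
    if unlift ord0 j is Some j' then
      fitt_summand_map (forms G) j (fun p => forms G i * p) (x j')
    else 0.

Lemma mul_form_ideal j p : p \in fitt_ideal (forms (deletion G i)) j ->
  forms G i * p \in fitt_ideal (forms G) j.+1.
Proof.
move=> /asboolP[c ->]; rewrite mulr_sumr; apply: fitt_ideal_sum => S /eqP Sj.
have iS : i \notin lift i @: S.
  by apply/imsetP => -[s _ /eqP]; rewrite (negPf (neq_lift _ _)).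
have -> : forms G i * (c S * \prod_(s in S) forms (deletion G i) s) =
    c S * \prod_(s in i |: lift i @: S) forms G s.
  rewrite big_setU1 //= big_imset => [|s t _ _]; last exact: lift_inj.
  rewrite mulrCA; congr (_ * (_ * _)).
  by apply: eq_bigr => s _; rewrite forms_deletion.
apply: fitt_ideal_gen; rewrite cardsU1 iS card_imset ?Sj //.
exact: lift_inj.
Qed.

Lemma mul_form_is_linear : linear mul_form.
Proof.
move=> a x y; apply: functional_extensionality_dep => j.
transitivity (a *: mul_form x j + mul_form y j) => //; rewrite /mul_form.
case: unliftP => [j' jE|_]; last by rewrite scaler0 addr0.
have jE' : j = j'.+1 :> nat by rewrite jE.
apply: (subquot_map_semilinear _ _ _ (phi := id)) => [p q|p|p|b p].
- exact: mulrBr.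
- by rewrite jE'; apply: mul_form_ideal.
- by rewrite jE'; apply: mul_form_ideal.
- exact: mulrCA.
Qed.

HB.instance Definition _ := GRing.isLinear.Build {mpoly K[k.+1]}
  (Fitt (forms (deletion G i))) (Fitt (forms G)) _ mul_form mul_form_is_linear.

Variable A : 'M[K]_k.+1.

(** In the coordinates ['Y] for which [\sum_r G r j *: 'X_r] becomes
    [\sum_s (A *m G) s j *: 'Y_s], one has ['X_r = \sum_s A s r *: 'Y_s]; when
    column [i] of [A *m G] is [(0, ..., 0, 1)^T], the [i]-th form is the last
    ['Y_s], which the quotient by it sends to [0]. *)
Definition quot_form (p : {mpoly K[k.+1]}) : {mpoly K[k]} :=
  p \mPo [tuple \sum_(s < k) A (lift ord_max s) r *: 'X_s | r < k.+1].

Fact quot_form_monoid : monoid_morphism quot_form.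
Proof.
by split; [exact: comp_mpoly1 | exact: (comp_mpoly_is_multiplicative _).1].
Qed.

HB.instance Definition _ :=
  GRing.isZmodMorphism.Build {mpoly K[k.+1]} {mpoly K[k]} quot_form
    (comp_mpoly_is_additive _).
HB.instance Definition _ :=
  GRing.isMonoidMorphism.Build {mpoly K[k.+1]} {mpoly K[k]} quot_form
    quot_form_monoid.

Lemma quot_form_forms j :
  quot_form (forms G j) = \sum_(s < k) (A *m G) (lift ord_max s) j *: 'X_s.
Proof.
rewrite /quot_form /forms raddf_sum /=.
under eq_bigr => r _ do
  rewrite comp_mpolyZ comp_mpolyXU -tnth_nth tnth_mktuple scaler_sumr.
rewrite exchange_big; apply: eq_bigr => s _ /=.
by rewrite mxE scaler_suml; apply: eq_bigr => r _; rewrite scalerA mulrC.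
Qed.

Hypothesis colA : col i (A *m G) = delta_mx ord_max 0.

Lemma quot_form_form : quot_form (forms G i) = 0.
Proof.
rewrite quot_form_forms big1 // => s _.
have := congr1 (fun c : 'cV_k.+1 => c (lift ord_max s) 0) colA.
by rewrite !mxE eq_sym (negPf (neq_lift _ _)) => ->; rewrite scale0r.
Qed.

Lemma quot_form_forms_lift j :
  quot_form (forms G (lift i j)) = forms (restriction (A *m G) i) j.
Proof. by rewrite quot_form_forms; apply: eq_bigr => s _; rewrite !mxE. Qed.

Lemma quot_form_ideal j p : p \in fitt_ideal (forms G) j ->
  quot_form p \in fitt_ideal (forms (restriction (A *m G) i)) j.
Proof.
move=> /asboolP[c ->]; rewrite rmorph_sum; apply: fitt_ideal_sum => S /eqP Sj.
rewrite rmorphM rmorph_prod; have [iS|iS] := boolP (i \in S).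
  by rewrite (bigD1 i) //= quot_form_form mul0r mulr0; apply: rpred0.
have SE : S = lift i @: (lift i @^-1: S).
  apply/setP => s; apply/idP/imsetP => [sS|[t]]; last by rewrite inE => ? ->.
  case: (unliftP i s) => [t sE|sE]; last by rewrite sE (negPf iS) in sS.
  by exists t; rewrite ?inE -?sE.
rewrite [in X in _ * X]SE big_imset /=; last by move=> s t _ _; exact: lift_inj.
under eq_bigr => s _ do rewrite quot_form_forms_lift.
apply: fitt_ideal_gen; rewrite -Sj [in RHS]SE card_imset //; exact: lift_inj.
Qed.

(** Induced by [quot_form] on the summands [j <= n]; the summand [n + 1], for
    which there is no summand in the target, is sent to [0]. *)
Definition restriction_map of col i (A *m G) = delta_mx ord_max 0 :=
  fun (x : Fitt (forms G)) =>
  (fun j : 'I_n.+1 => fitt_summand_map _ j quot_form (x (widen_ord (leqnSn _) j)))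
  : restrict_scalars quot_form (Fitt (forms (restriction (A *m G) i))).

Lemma restriction_map_is_linear : linear (restriction_map colA).
Proof.
move=> a x y; apply: functional_extensionality_dep => j.
apply: (subquot_map_semilinear _ _ _ (phi := quot_form)) => [p q|p|p|b p].
- exact: rmorphB.
- exact: quot_form_ideal.
- exact: quot_form_ideal.
- exact: rmorphM.
Qed.

HB.instance Definition _ := GRing.isLinear.Build {mpoly K[k.+1]}
  (Fitt (forms G))
  (restrict_scalars quot_form (Fitt (forms (restriction (A *m G) i))))
  _ (restriction_map colA) restriction_map_is_linear.

End DeletionRestriction.

Arguments mul_form {K k n} G i x.
Arguments quot_form {K k} A p.
Arguments restriction_map {K k n G i A} colA x.
Arguments Fitt_piece {K k N} Sigma t x.

(* Main.v *)
Require Import Defs.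
From HB Require Import structures.
From mathcomp Require Import all_boot all_order all_algebra.
From mathcomp Require Import mpoly ring zify.

Set Implicit Arguments.
Unset Strict Implicit.
Unset Printing Implicit Defensive.

Import GRing.Theory.
Local Open Scope ring_scope.

(** Write [l] for the [i]-th form, [I j] for the ideal of [j]-fold products of
    all the forms, [I' j] for that of the forms other than [l], and [I'' j] for
    the one of their images modulo [l].  Sorting the products according to
    whether they contain [l] gives the decomposition
      [I (j + 1) = l * I' j + I' (j + 1)]  ([fitt_ideal_deletionP]).

    Everything else about the sequence reduces to one colon statement,
      if [l * p] lies in [I' (m + 1)] then [p] lies in [I' m]
    ([fitt_ideal_deletion_colon]), the only place where MDS enters.
    - Injectivity: if [l * p] lies in [I (j + 2) = l * I' (j + 1) + I' (j + 2)],
      then [l * (p - a)] lies in [I' (j + 2)] for some [a] in [I' (j + 1)],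
      hence [p] is in [I' (j + 1)].
    - Exactness in the middle: let [w] be in [I (j + 1)] with image in
      [I'' (j + 2)].  That image lifts to some [c] in [I' (j + 2)] and
      [w - c = l * r], the kernel of the restriction being generated by [l].
      Writing [w = l * a + b] as above, [l * (r - a) = b - c] lies in
      [I' (j + 1)], so [r] lies in [I' j]: modulo [I (j + 2)], the element [w]
      is [l] times an element of [I' j].
    - Surjectivity: products of forms modulo [l] lift to products of forms.

    For the colon statement, let [K] be the number of variables and [n] the
    number of forms other than [l].  The MDS property says that any at most [K]
    of the [n + 1] forms are linearly independent ([MDS_generic]), and there are
    two ranges.
    - For [m + K <= n + 1], the ideal [I' m] is the [m]-th power of the
      irrelevant ideal ([min_deg_fitt_ideal], [fitt_ideal_min_deg]): a product
      of fewer than [m] forms leaves at least [K] forms aside, and these span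
      all linear forms.  The statement is then about lowest degrees.
    - For [n + 2 <= K + m], the form [l] is a nonzerodivisor modulo [I' m]
      ([fitt_ideal_nzd]).  This is proved by induction on the number of forms,
      for ideals [I' m + <T>] where [T] is a list of further forms, so that
      passing to the quotient by a form amounts to moving it to [T]; at the
      bottom stands the primality of [<T>] ([lin_ideal_prime]). *)

(** * Ideals of products of forms *)

Section FittingIdeals.
Variables (A : comNzRingType).

Lemma fitt_idealD N (Sigma : 'I_N -> A) j p q :
  p \in fitt_ideal Sigma j -> q \in fitt_ideal Sigma j ->
  p + q \in fitt_ideal Sigma j.
Proof. exact: (@rpredD A^o (fitt_ideal Sigma j)). Qed.

Lemma fitt_idealB N (Sigma : 'I_N -> A) j p q :
  p \in fitt_ideal Sigma j -> q \in fitt_ideal Sigma j ->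
  p - q \in fitt_ideal Sigma j.
Proof. exact: (@rpredB A^o (fitt_ideal Sigma j)). Qed.

Lemma fitt_ideal_zero N (Sigma : 'I_N -> A) j : 0 \in fitt_ideal Sigma j.
Proof. exact: (@rpred0 A^o (fitt_ideal Sigma j)). Qed.

Lemma fitt_idealM N (Sigma : 'I_N -> A) j a p :
  p \in fitt_ideal Sigma j -> a * p \in fitt_ideal Sigma j.
Proof. exact: (@rpredZ _ A^o (fitt_ideal Sigma j) a p). Qed.

Lemma eq_fitt_ideal N (Sigma Sigma' : 'I_N -> A) j :
  Sigma =1 Sigma' -> fitt_ideal Sigma j =i fitt_ideal Sigma' j.
Proof.
suff sub (S S' : 'I_N -> A) : S =1 S' ->
    {subset fitt_ideal S j <= fitt_ideal S' j}.
  by move=> E p; apply/idP/idP; apply: sub => // s; rewrite E.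
move=> E p /boolp.asboolP[c ->]; apply: fitt_ideal_sum => T /eqP Tj.
by rewrite (eq_bigr S') //; apply: fitt_ideal_gen.
Qed.

Lemma fitt_ideal_gt N (Sigma : 'I_N -> A) j p :
  (N < j)%N -> p \in fitt_ideal Sigma j -> p = 0.
Proof.
move=> Nj /boolp.asboolP[c ->]; rewrite big1 // => S /eqP Sj.
by have := max_card S; rewrite card_ord Sj leqNgt Nj.
Qed.

Lemma lift_preimset N (i : 'I_N.+1) (S : {set 'I_N.+1}) :
  S :\ i = lift i @: (lift i @^-1: S).
Proof.
apply/setP => s; rewrite !inE; apply/idP/imsetP => [/andP[si sS]|[t]].
  case: (unliftP i s) => [t sE|sE]; last by rewrite sE eqxx in si.
  by exists t; rewrite ?inE -?sE.
by rewrite inE => tS ->; rewrite tS andbT eq_sym neq_lift.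
Qed.

(** Sort the products of [j + 1] forms by whether they contain the [i]-th. *)
Lemma fitt_idealSP N (Sigma : 'I_N.+1 -> A) i j p :
  p \in fitt_ideal Sigma j.+1 <->
  exists a b, [/\ a \in fitt_ideal (fun s => Sigma (lift i s)) j,
                  b \in fitt_ideal (fun s => Sigma (lift i s)) j.+1
                & p = Sigma i * a + b].
Proof.
have inj : injective (lift i) by exact: lift_inj.
split=> [/boolp.asboolP[c ->]|[a [b [/boolp.asboolP[c ->] /boolp.asboolP[d ->] ->]]]].
  apply: (big_ind (fun p => exists a b,
    [/\ a \in fitt_ideal (fun s => Sigma (lift i s)) j,
        b \in fitt_ideal (fun s => Sigma (lift i s)) j.+1
      & p = Sigma i * a + b])).
  - by exists 0, 0; split; rewrite ?fitt_ideal_zero ?mulr0 ?addr0.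
  - move=> _ _ [a [b [aI bI ->]]] [a' [b' [aI' bI' ->]]].
    exists (a + a'), (b + b'); split; rewrite ?fitt_idealD //.
    by rewrite mulrDr addrACA.
  move=> S /eqP Sj; set S' := lift i @^-1: S.
  have cS : #|S :\ i| = #|S'| by rewrite lift_preimset card_imset.
  have pS : \prod_(s in S :\ i) Sigma s = \prod_(s in S') Sigma (lift i s).
    by rewrite lift_preimset big_imset //= => s t _ _; apply: inj.
  have [iS|iS] := boolP (i \in S).
    exists (c S * \prod_(s in S') Sigma (lift i s)), 0.
    split; rewrite ?fitt_ideal_zero //.
      by apply: fitt_ideal_gen; apply/eqP; rewrite -cS -eqSS -Sj (cardsD1 i S) iS.
    by rewrite (big_setD1 i) //= pS addr0 mulrCA.
  have SD : S :\ i = S by apply/setDidPl; rewrite disjoint_sym disjoints1.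
  exists 0, (c S * \prod_(s in S') Sigma (lift i s)).
  split; rewrite ?fitt_ideal_zero //.
    by apply: fitt_ideal_gen; rewrite -cS SD.
  by rewrite mulr0 add0r -pS SD.
have prodE (S : {set 'I_N}) :
    \prod_(s in S) Sigma (lift i s) = \prod_(s in lift i @: S) Sigma s.
  by rewrite big_imset //= => s t _ _; apply: inj.
apply: fitt_idealD; last first.
  apply: fitt_ideal_sum => S /eqP Sj.
  by rewrite prodE; apply: fitt_ideal_gen; rewrite card_imset.
rewrite mulr_sumr; apply: fitt_ideal_sum => S /eqP Sj.
have iS : i \notin lift i @: S.
  by apply/imsetP => -[s _ /eqP]; rewrite (negPf (neq_lift _ _)).
have -> : Sigma i * (c S * \prod_(s in S) Sigma (lift i s)) =
          c S * \prod_(s in i |: lift i @: S) Sigma s.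
  by rewrite big_setU1 //= mulrCA prodE.
by apply: fitt_ideal_gen; rewrite cardsU1 iS card_imset // Sj.
Qed.

End FittingIdeals.

(** * Linear forms and the prime ideals that they generate *)

Section LinearIdeals.
Variables (K : fieldType) (k : nat).
Local Notation R := {mpoly K[k]}.
Implicit Types (u v x y : 'cV[K]_k) (T : seq 'cV[K]_k) (p q : R).

Definition lform u : R := \sum_(r < k) u r 0 *: 'X_r.

Fact lform_is_linear : linear lform.
Proof.
move=> a u v; rewrite /lform scaler_sumr -big_split; apply: eq_bigr => r _ /=.
by rewrite !mxE scalerDl scalerA.
Qed.

HB.instance Definition _ :=
  GRing.isLinear.Build K 'cV[K]_k R _ lform lform_is_linear.

Lemma lform_delta r : lform (delta_mx r 0) = 'X_r.
Proof.
rewrite /lform (bigD1 r) //= mxE !eqxx scale1r big1 ?addr0 // => s sr.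
by rewrite mxE (negPf sr) scale0r.
Qed.

Lemma lform_homog u : lform u \is 1.-homog.
Proof.
by apply: rpred_sum => r _; apply: rpredZ; rewrite dhomogX /= mdeg1.
Qed.

Lemma lform_eq0 u : (lform u == 0) = (u == 0).
Proof.
apply/eqP/eqP => [u0|->]; last exact: raddf0.
apply/colP => r; rewrite mxE; have := congr1 (mcoeff U_(r)%MM) u0.
rewrite mcoeff0 /lform raddf_sum (bigD1 r) //= mcoeffZ mcoeffXU eqxx mulr1.
rewrite big1 ?addr0 // => s sr.
by rewrite mcoeffZ mcoeffXU (negPf sr) mulr0.
Qed.

(** The ideal generated by the forms of [T].  The recursive form makes moving
    one form into [T], on which the induction of [fitt_ideal_nzd] rests,
    hold by definition. *)
Fixpoint lin_ideal T p : Prop :=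
  if T is y :: T' then exists q, lin_ideal T' (p - lform y * q) else p = 0.

Lemma lin_ideal0 T : lin_ideal T 0.
Proof. by elim: T => //= y T IH; exists 0; rewrite mulr0 subr0. Qed.

Lemma lin_idealD T p q : lin_ideal T p -> lin_ideal T q -> lin_ideal T (p + q).
Proof.
elim: T p q => [|y T IH] p q /=; first by move=> -> ->; rewrite addr0.
by move=> [a pa] [b qb]; exists (a + b); rewrite mulrDr opprD addrACA; apply: IH.
Qed.

Lemma lin_idealM T a p : lin_ideal T p -> lin_ideal T (a * p).
Proof.
elim: T p => [|y T IH] p /=; first by move=> ->; rewrite mulr0.
by move=> [b pb]; exists (a * b); rewrite mulrCA -mulrBr; apply: IH.
Qed.

Lemma lin_idealN T p : lin_ideal T p -> lin_ideal T (- p).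
Proof. by rewrite -mulN1r; apply: lin_idealM. Qed.

Lemma lin_idealB T p q : lin_ideal T p -> lin_ideal T q -> lin_ideal T (p - q).
Proof. by move=> ? ?; apply: lin_idealD => //; apply: lin_idealN. Qed.

Lemma lin_ideal_span T u : u \in <<T>>%VS -> lin_ideal T (lform u).
Proof.
elim: T u => [|y T IH] u /=.
  by rewrite span_nil memv0 => /eqP ->; rewrite raddf0.
rewrite span_cons => /memv_addP[_ /vlineP[c ->] [v vT ->]].
exists c%:MP; rewrite linearP /= [_ * c%:MP]mulrC mul_mpolyC addrAC subrr add0r.
exact: IH.
Qed.

(** A substitution that moves each variable by an element of an ideal moves
    every polynomial by an element of it. *)
Lemma lin_ideal_subst T (f : {rmorphism R -> R}) :
  (forall c, f c%:MP = c%:MP) -> (forall r, lin_ideal T ('X_r - f 'X_r)) ->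
  forall p, lin_ideal T (p - f p).
Proof.
move=> fC fX.
have fM p q : lin_ideal T (p - f p) -> lin_ideal T (q - f q) ->
    lin_ideal T (p * q - f (p * q)).
  move=> pT qT; rewrite rmorphM /=.
  have -> : p * q - f p * f q = p * (q - f q) + f q * (p - f p).
    by ring.
  by apply: lin_idealD; apply: lin_idealM.
move=> p; rewrite [p]mpolyE rmorph_sum -sumrB.
apply: (big_ind (lin_ideal T)); [exact: lin_ideal0|exact: lin_idealD|].
move=> m _; rewrite -mul_mpolyC; apply: (fM).
  by rewrite fC subrr; apply: lin_ideal0.
rewrite mpolyXE_id; apply: (big_ind (fun q => lin_ideal T (q - f q))).
- by rewrite rmorph1 subrr; apply: lin_ideal0.
- exact: fM.
move=> r _; elim: (m r) => [|e IH]; last by rewrite exprS; apply: (fM).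
by rewrite expr0 rmorph1 subrr; apply: lin_ideal0.
Qed.

(** The substitution that performs, on linear forms, the projection with
    kernel [U] onto a complement; its kernel is the ideal generated by [U],
    see [lin_idealP]. *)
Definition proj_subst (U : {vspace 'cV[K]_k}) p : R :=
  p \mPo [tuple lform (delta_mx r 0 - projv U (delta_mx r 0)) | r < k].

HB.instance Definition _ U := GRing.RMorphism.copy (proj_subst U)
  (comp_mpoly [tuple lform (delta_mx r 0 - projv U (delta_mx r 0)) | r < k]).

Lemma proj_substX U r :
  proj_subst U 'X_r = lform (delta_mx r 0 - projv U (delta_mx r 0)).
Proof. by rewrite /proj_subst comp_mpolyXU -tnth_nth tnth_mktuple. Qed.

Lemma proj_subst_lform U u : proj_subst U (lform u) = lform (u - projv U u).
Proof.
have projZ c p : proj_subst U (c *: p) = c *: proj_subst U p.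
  exact: comp_mpolyZ.
rewrite {1}/lform raddf_sum /=.
under eq_bigr => r _ do rewrite projZ proj_substX -linearZ.
rewrite -raddf_sum; congr lform.
have uE : u = \sum_(r < k) u r 0 *: delta_mx r 0.
  by rewrite [LHS]matrix_sum_delta; apply: eq_bigr => r _; rewrite big_ord1.
rewrite [in RHS]uE linear_sum -sumrB; apply: eq_bigr => r _.
by rewrite linearZ scalerBr.
Qed.

Lemma lin_idealP T p : lin_ideal T p <-> proj_subst <<T>> p = 0.
Proof.
split=> [|p0]; last first.
  rewrite -[p]subr0 -p0; apply: lin_ideal_subst => [c|r].
    exact: comp_mpolyC.
  rewrite /= proj_substX -lform_delta -raddfB opprB addrC subrK.
  exact/lin_ideal_span/memv_proj.
have sub : {subset T <= <<T>>%VS} by move=> y; apply: memv_span.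
elim: {1 3}T sub p => [|y T' IH] sub p /=; first by move=> ->; rewrite raddf0.
case=> q /IH; rewrite rmorphB rmorphM /= proj_subst_lform projv_id.
  rewrite subrr raddf0 mul0r subr0; apply=> z zT; apply: sub.
  by rewrite inE zT orbT.
by apply: sub; rewrite mem_head.
Qed.

(** The ideal is the kernel of a ring morphism into an integral domain, which
    does not kill a form outside the span of [T]. *)
Lemma lin_ideal_prime T x p :
  x \notin <<T>>%VS -> lin_ideal T (lform x * p) -> lin_ideal T p.
Proof.
move=> xT /lin_idealP; rewrite rmorphM /= proj_subst_lform => /eqP.
rewrite mulf_eq0 lform_eq0 => /orP[|/eqP]; last by move/lin_idealP.
by rewrite subr_eq0 => /eqP xE; case/negP: xT; rewrite xE memv_proj.
Qed.

(** * Generic forms: the nonzerodivisor range *)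

(** Lists up to permutation, rather than indexed families, make the property
    pass to the families obtained by moving a form or dropping one. *)
Definition generic (X : seq 'cV[K]_k) : Prop :=
  forall Y Z, perm_eq (Y ++ Z) X -> (size Y <= k)%N -> free Y.

Lemma generic_perm X X' : perm_eq X X' -> generic X -> generic X'.
Proof.
move=> XX' gX Y Z YZ; apply: (gX Y Z).
by rewrite (perm_trans YZ) // perm_sym.
Qed.

Lemma generic_behead y X : generic (y :: X) -> generic X.
Proof.
move=> gX Y Z YZ; apply: (gX Y (y :: Z)).
by rewrite perm_catC /= perm_cons perm_catC.
Qed.

(** Let [y] be the first form of [Sigma] and [J m] the ideals of products of
    the others.  If [x * p] is in [y * J (m - 1) + J m + <T>], then modulo [y]
    the induction hypothesis gives [p = b' + y * q] with [b'] in [J m].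
    Therefore [y * (x * q - a)] lies in [J m + <T>] for some [a] in
    [J (m - 1)]; cancelling [y], and then [x], by induction yields that [q]
    is in [J (m - 1) + <T>].  The numerical hypotheses are stable under both
    moving a form to [T] and dropping one; when [n < m] the ideal of products
    vanishes and only the primality of [<T>] is left. *)
Lemma fitt_ideal_nzd n (Sigma : 'I_n -> 'cV[K]_k) T x m p :
  generic (x :: T ++ [seq Sigma i | i <- enum 'I_n]) ->
  (size T < k)%N -> (n + size T + 2 <= k + m)%N ->
  (exists2 b, b \in fitt_ideal (lform \o Sigma) m &
     lin_ideal T (lform x * p - b)) ->
  exists2 b, b \in fitt_ideal (lform \o Sigma) m & lin_ideal T (p - b).
Proof.
have base n' (Sigma' : 'I_n' -> 'cV[K]_k) T' x' m' p' : (n' < m')%N ->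
    generic (x' :: T' ++ [seq Sigma' i | i <- enum 'I_n']) -> (size T' < k)%N ->
    (exists2 b, b \in fitt_ideal (lform \o Sigma') m' &
       lin_ideal T' (lform x' * p' - b)) ->
    exists2 b, b \in fitt_ideal (lform \o Sigma') m' & lin_ideal T' (p' - b).
  move=> nm gX Tk [b /(fitt_ideal_gt nm) ->]; rewrite subr0 => xp.
  exists 0; first exact: fitt_ideal_zero.
  rewrite subr0; apply: lin_ideal_prime xp.
  by have := gX (x' :: T') _ (perm_refl _) Tk; rewrite free_cons => /andP[].
elim: n => [|n IH] in Sigma T x m p *.
  case: m => [|m] gX Tk _; last exact: base.
  by move=> _; exists p; rewrite ?fitt_ideal0 ?subrr //; apply: lin_ideal0.
have [nm gX Tk _|] := ltnP n.+1 m; first exact: base.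
case: m => [|m] mn gX Tk le.
  move=> _; exists p; last by rewrite subrr; apply: lin_ideal0.
  exact: fitt_ideal0.
set y := Sigma ord0; pose Sigma1 i := Sigma (lift ord0 i).
have Sigma1E: [seq Sigma i | i <- enum 'I_n.+1] =
    y :: [seq Sigma1 i | i <- enum 'I_n].
  by rewrite enum_ordSl /= -map_comp.
rewrite Sigma1E in gX.
have splitP j q := fitt_idealSP (lform \o Sigma) ord0 j q.
case=> _ /splitP[a [b [aI bI ->]]] xpT.
(* modulo the form [y], only the products avoiding [y] survive *)
have [||||b' b'I [q /= pT]] := IH Sigma1 (y :: T) x m.+1 p.
- apply: generic_perm gX; apply/permP => c.
  by rewrite /= !count_cat /=; lia.
- by rewrite /=; lia.
- by rewrite /=; lia.
- exists b => //=; exists a.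
  by move: xpT; rewrite opprD addrA addrAC.
have gy : generic (y :: T ++ [seq Sigma1 i | i <- enum 'I_n]).
  apply: (@generic_behead x); apply: generic_perm gX; apply/permP => c.
  by rewrite /= !count_cat /=; lia.
have gx : generic (x :: T ++ [seq Sigma1 i | i <- enum 'I_n]).
  apply: (@generic_behead y); apply: generic_perm gX; apply/permP => c.
  by rewrite /= !count_cat /=; lia.
have [||||c cI cT] := IH Sigma1 T y m.+1 (lform x * q - a) => //.
- by lia.
- exists (b - lform x * b'); first by rewrite fitt_idealB ?fitt_idealM.
  have := lin_idealB xpT (lin_idealM (lform x) pT).
  by congr lin_ideal; rewrite /= -/y; ring.
have [||||d dI dT] := IH Sigma1 T x m q => //.
- by lia.
- exists (a + c); first by rewrite fitt_idealD // fitt_ideal_sub.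
  by rewrite opprD addrA.
exists (lform y * d + b'); first by apply/splitP; exists d, b'.
have := lin_idealD pT (lin_idealM (lform y) dT).
by congr lin_ideal; ring.
Qed.

(** * Generic forms: the range of powers of the irrelevant ideal *)

Lemma generic_span X Y Z : generic X -> perm_eq (Y ++ Z) X ->
  (k <= size Y)%N -> <<Y>>%VS = fullv.
Proof.
move=> gX YZ kY.
have fY : free (take k Y).
  apply: (gX _ (drop k Y ++ Z)); last by rewrite size_takel.
  by rewrite catA cat_take_drop.
apply/eqP; rewrite eqEdim subvf dimvf /dim /= muln1.
rewrite -{1}(size_takel kY) -(eqP fY); apply/dimvS/sub_span => u.
exact: mem_take.
Qed.

(** The forms outside a product of [j <= n - k] of them span all linear forms,
    so multiplying the product by any linear form gives a combination of
    products of [j + 1] distinct forms. *)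
Lemma lform_mul_fitt_ideal n (Sigma : 'I_n -> 'cV[K]_k) j u a :
  generic [seq Sigma i | i <- enum 'I_n] -> (j + k <= n)%N ->
  a \in fitt_ideal (lform \o Sigma) j ->
  lform u * a \in fitt_ideal (lform \o Sigma) j.+1.
Proof.
move=> gS jk /boolp.asboolP[c ->]; rewrite mulr_sumr.
apply: fitt_ideal_sum => S /eqP Sj; set q := c S * _.
have qt t : t \notin S ->
    lform (Sigma t) * q \in fitt_ideal (lform \o Sigma) j.+1.
  move=> tS.
  have -> : lform (Sigma t) * q = c S * \prod_(s in t |: S) (lform \o Sigma) s.
    by rewrite big_setU1 //= mulrCA.
  by apply: fitt_ideal_gen; rewrite cardsU1 tS Sj.
pose Y := [seq Sigma t | t <- enum (~: S)].
have Yfull : <<Y>>%VS = fullv.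
  apply: (generic_span (Z := [seq Sigma t | t <- enum S]) gS).
    rewrite -map_cat; apply: perm_map; apply: uniq_perm.
    - rewrite cat_uniq !enum_uniq andbT /=; apply/hasPn => t.
      by rewrite !mem_enum inE negbK.
    - exact: enum_uniq.
    - by move=> t; rewrite mem_cat !mem_enum inE orNb.
  by rewrite size_map -cardE -(leq_add2l j) -{2}Sj cardsC card_ord.
have : u \in <<Y>>%VS by rewrite Yfull memvf.
have : {in Y, forall y, lform y * q \in fitt_ideal (lform \o Sigma) j.+1}.
  by move=> y /mapP[t]; rewrite mem_enum inE => tS ->; apply: qt.
elim: (Y) u => [|y Y' IH] u yI.
  by rewrite span_nil memv0 => /eqP ->; rewrite raddf0 mul0r fitt_ideal_zero.
rewrite span_cons => /memv_addP[_ /vlineP[e ->] [v vY ->]].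
rewrite linearP /= mulrDl fitt_idealD //.
  by rewrite -mul_mpolyC -mulrA fitt_idealM // yI ?mem_head.
by apply: IH => // z zY; apply: yI; rewrite inE zY orbT.
Qed.

(** Membership in the [j]-th power of the ideal of the variables. *)
Definition min_deg j p : Prop := forall m, (mdeg m < j)%N -> p@_m = 0.

Lemma min_degD j p q : min_deg j p -> min_deg j q -> min_deg j (p + q).
Proof. by move=> pj qj m mj; rewrite mcoeffD pj ?qj ?addr0. Qed.

Lemma min_degN j p : min_deg j p -> min_deg j (- p).
Proof. by move=> pj m mj; rewrite mcoeffN pj ?oppr0. Qed.

Lemma min_degM i j p q : min_deg i p -> min_deg j q -> min_deg (i + j) (p * q).
Proof.
move=> pi qj m; apply: contraTeq; rewrite mcoeff_eq0 negbK -leqNgt.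
move/msuppM_le/allpairsP=> [[m1 m2] /= [m1p m2q ->]]; rewrite mdegD.
apply: leq_add; rewrite leqNgt; apply/negP.
  by move/pi/eqP; rewrite mcoeff_eq0 m1p.
by move/qj/eqP; rewrite mcoeff_eq0 m2q.
Qed.

Lemma dhomog_min_deg d p : p \is d.-homog -> min_deg d p.
Proof. by move=> pd m md; rewrite (dhomog_nemf_coeff pd) // neq_ltn md. Qed.

Lemma dhomog_min_degS d p : p \is d.-homog -> min_deg d.+1 p -> p = 0.
Proof.
move=> pd p0; apply/mpolyP => m; rewrite mcoeff0.
have [md|md] := eqVneq (mdeg m) d; first by rewrite p0 ?md.
exact: dhomog_nemf_coeff pd md.
Qed.

Lemma mcoeff_pihomog d p m : (pihomog mdeg d p)@_m = p@_m *+ (mdeg m == d).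
Proof.
rewrite pihomogE raddf_sum big_mkcond /= [in RHS](mpolyE p) raddf_sum -sumrMnl.
apply: eq_bigr => m' _; rewrite /= !mcoeffZ !mcoeffX.
have [->|_] := eqVneq m' m; first by case: (_ == d).
by rewrite mulr0 mul0rn if_same.
Qed.

Lemma min_deg_pihomog j p :
  min_deg j p -> min_deg j.+1 (p - pihomog mdeg j p).
Proof.
move=> pj m; rewrite ltnS mcoeffB mcoeff_pihomog leq_eqVlt.
case: eqP => [_ _|_ /= /pj ->]; first by rewrite subrr.
by rewrite mul0rn subrr.
Qed.

Lemma fitt_ideal_min_deg n (Sigma : 'I_n -> 'cV[K]_k) j p :
  p \in fitt_ideal (lform \o Sigma) j -> min_deg j p.
Proof.
move=> /boolp.asboolP[c ->]; apply: (big_ind (min_deg j)) => [m _||S /eqP <-].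
- by rewrite mcoeff0.
- exact: min_degD.
rewrite -[#|S|]add0n; apply: min_degM => //; rewrite -sum1_card.
apply: (big_ind2 (fun q d => min_deg d q)) => [m //||s _].
- by move=> q d q' d'; apply: min_degM.
- exact/dhomog_min_deg/lform_homog.
Qed.

(** Peel the variables off a monomial one at a time. *)
Lemma min_deg_fitt_ideal n (Sigma : 'I_n -> 'cV[K]_k) j p :
  generic [seq Sigma i | i <- enum 'I_n] -> (j + k <= n.+1)%N ->
  min_deg j p -> p \in fitt_ideal (lform \o Sigma) j.
Proof.
move=> gS jk pj; rewrite [p]mpolyE big_seq; apply: fitt_ideal_sum => m mp.
rewrite -mul_mpolyC; apply: fitt_idealM.
have {mp pj}: (j <= mdeg m)%N.
  rewrite leqNgt; apply: contraL mp => mj.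
  by rewrite -mcoeff_eq0 pj.
elim: j m jk => [|j IH] m jk jm; first exact: fitt_ideal0.
have [r mr] : exists r, m r != 0%N.
  apply/existsP; apply: contraTT jm; rewrite negb_exists => /forallP m0.
  rewrite -ltnNge mdegE big1 // => r _; apply/eqP.
  by have := m0 r; rewrite negbK.
have mE : m = (U_(r) + (m - U_(r)))%MM.
  rewrite addmC submK //; apply/mnm_lepP => s; rewrite mnm1E.
  by case: eqP => [<-|//]; rewrite lt0n.
rewrite mE mpolyXD -lform_delta; apply: lform_mul_fitt_ideal => //.
apply: IH; first by lia.
by move: jm; rewrite {1}mE mdegD mdeg1.
Qed.

(** The lowest homogeneous component of [lform x * p] is [lform x] times that
    of [p], as polynomials form an integral domain. *)
Lemma min_deg_lform_mul x m p :
  x != 0 -> min_deg m.+1 (lform x * p) -> min_deg m p.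
Proof.
move=> x0 xp.
suff : forall j, (j <= m)%N -> min_deg j p by apply.
elim=> [//|j IH] jm; have pj := IH (ltnW jm).
set h := pihomog mdeg j p; have pr : min_deg j.+1 (p - h) by apply: min_deg_pihomog.
suff h0 : h = 0 by rewrite h0 subr0 in pr.
apply/eqP; rewrite -[_ == 0]orFb -(negPf x0) -lform_eq0 -mulf_eq0; apply/eqP.
apply: (@dhomog_min_degS j.+1).
  by rewrite -add1n dhomogM ?lform_homog ?pihomogP.
have -> : lform x * h = lform x * p + - (lform x * (p - h)) by ring.
apply: min_degD; first by move=> e ej; apply: xp; lia.
apply: min_degN; rewrite -[j.+2]add1n.
by apply: min_degM => //; apply: dhomog_min_deg; apply: lform_homog.
Qed.

(** * The colon property and MDS codes *)

(** The two ranges below cover all [m]; only the second one loses a degree. *)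
Lemma fitt_ideal_colon n (Sigma : 'I_n -> 'cV[K]_k) x m p : (0 < k)%N ->
  generic (x :: [seq Sigma i | i <- enum 'I_n]) ->
  lform x * p \in fitt_ideal (lform \o Sigma) m.+1 ->
  p \in fitt_ideal (lform \o Sigma) m.
Proof.
move=> k0 gX xpI; have [le|lt] := leqP (n + 2) (k + m.+1).
  have [||||b bI /=] := @fitt_ideal_nzd n Sigma [::] x m.+1 p => //.
  - by rewrite addn0.
  - by exists (lform x * p) => //=; rewrite subrr.
  by move/eqP; rewrite subr_eq0 => /eqP ->; apply: fitt_ideal_sub.
apply: min_deg_fitt_ideal; [exact: generic_behead gX|lia|].
apply: min_deg_lform_mul (fitt_ideal_min_deg xpI).
by have := gX [:: x] _ (perm_refl _) k0; rewrite seq1_free.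
Qed.

End LinearIdeals.

Lemma forms_lform (K : fieldType) k n (G : 'M[K]_(k, n)) j :
  forms G j = lform (col j G).
Proof. by apply: eq_bigr => r _; rewrite mxE. Qed.

(** If [k + 1] columns were dependent, some nonzero [v] would be orthogonal to
    all of them, and the nonzero codeword [v *m G] would have weight at most
    [n - k], one less than the minimum distance of an MDS code.  A shorter
    list is first completed to [k + 1] columns. *)
Lemma MDS_generic (K : fieldType) k n (G : 'M[K]_(k.+1, n.+1)) :
  MDS G -> generic [seq col j G | j <- enum 'I_n.+1].
Proof.
case=> Gfree [_ Gdist] Y Z YZ sY.
have kn : (k <= n)%N.
  move: Gfree; rewrite -ltnS -row_leq_rank => /leq_trans; apply.
  exact: rank_leq_col.
have sYZ : (size Y + size Z = n.+1)%N.
  by rewrite -size_cat (perm_size YZ) size_map size_enum_ord.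
wlog {sY} sY : Y Z YZ sYZ / size Y = k.+1 => [wlog_free|].
  apply: (@catl_free _ _ (take (k.+1 - size Y) Z)).
  apply: (wlog_free _ (drop (k.+1 - size Y) Z)).
  - by rewrite -catA cat_take_drop.
  - by rewrite -size_cat -catA cat_take_drop size_cat.
  - by rewrite size_cat size_takel; lia.
pose M := \matrix_(r < k.+1, a < k.+1) (Y`_a : 'cV[K]_k.+1) r 0.
have [Mfree|] := boolP (row_free M).
  pose Yt : k.+1.-tuple 'cV[K]_k.+1 := Tuple (introT eqP sY).
  rewrite -[Y]/(tval Yt); apply/freeP => c c0 a.
  have : M *m (\col_b c b) = 0.
    apply/colP => r; have := congr1 (fun u : 'cV_k.+1 => u r 0) c0.
    rewrite !mxE summxE => E; rewrite -[RHS]E; apply: eq_bigr => b _.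
    by rewrite !mxE mulrC.
  have Mu : M \in unitmx by rewrite -row_free_unit.
  move/(congr1 (mulmx (invmx M))); rewrite mulKmx // mulmx0 => /colP/(_ a).
  by rewrite !mxE.
rewrite -kermx_eq0 => /rowV0Pn[v /sub_kermxP vM v0].
have c0 : v *m G != 0 by rewrite mulmx_free_eq0.
have := Gdist _ (submxMl v G) c0; rewrite leqNgt; case/negP.
pose zero (u : 'cV[K]_k.+1) := (v *m u) 0 0 == 0.
have wE : (hamming_weight (v *m G) =
    count (predC zero) [seq col j G | j <- enum 'I_n.+1])%N.
  rewrite /hamming_weight cardE count_map -size_filter.
  apply: perm_size; apply: uniq_perm => [||j]; first exact: enum_uniq.
    exact/filter_uniq/enum_uniq.
  by rewrite [RHS]mem_filter !mem_enum !inE andbT /= /zero colE mulmxA -colE !mxE.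
(* [v] is orthogonal to the chosen columns, since [v *m M = 0]. *)
have zY : count zero Y = size Y.
  apply/eqP; rewrite -all_count; apply/(all_nthP 0) => a.
  rewrite sY => ak; have := congr1 (fun u : 'rV_k.+1 => u 0 (Ordinal ak)) vM.
  rewrite !mxE => E; apply/eqP; rewrite -[RHS]E mxE; apply: eq_bigr => r _.
  by rewrite mxE.
have := count_predC zero [seq col j G | j <- enum 'I_n.+1].
rewrite size_map size_enum_ord wE -(permP YZ) count_cat zY sY; lia.
Qed.

(** * Deletion, and the kernel of the restriction *)

Section DeletionRestriction.
Variables (K : fieldType) (k n : nat).
Variables (G : 'M[K]_(k.+1, n.+1)) (i : 'I_n.+1).
Local Notation R := {mpoly K[k.+1]}.

Lemma fitt_ideal_deletionP j p :
  p \in fitt_ideal (forms G) j.+1 <->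
  exists a b, [/\ a \in fitt_ideal (forms (deletion G i)) j,
                  b \in fitt_ideal (forms (deletion G i)) j.+1
                & p = forms G i * a + b].
Proof.
have E j' := eq_fitt_ideal j' (forms_deletion G i).
split=> [/(fitt_idealSP (forms G) i)|] [a [b [aI bI ->]]].
  by exists a, b; rewrite !E.
by apply/(fitt_idealSP (forms G) i); exists a, b; rewrite -!E.
Qed.

Lemma fitt_ideal_deletion_colon m p : MDS G ->
  forms G i * p \in fitt_ideal (forms (deletion G i)) m.+1 ->
  p \in fitt_ideal (forms (deletion G i)) m.
Proof.
move=> hG.
have E : forms (deletion G i) =1 @lform K k.+1 \o (fun s => col (lift i s) G).
  by move=> s; rewrite forms_deletion forms_lform.
rewrite !(eq_fitt_ideal _ E) forms_lform; apply: fitt_ideal_colon => //.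
apply: generic_perm (MDS_generic hG); rewrite perm_sym.
have -> : col i G :: [seq col (lift i s) G | s <- enum 'I_n] =
    [seq col j G | j <- i :: [seq lift i s | s <- enum 'I_n]].
  by rewrite /= -map_comp.
apply/perm_map/uniq_perm.
- rewrite /= (map_inj_uniq (@lift_inj _ i)) enum_uniq andbT.
  by apply/mapP => -[s _ /eqP]; rewrite (negPf (neq_lift _ _)).
- exact: enum_uniq.
move=> s; rewrite mem_enum inE; case: (unliftP i s) => [t ->|->].
  by rewrite map_f ?orbT // mem_enum.
by rewrite eqxx.
Qed.

Variable A : 'M[K]_k.+1.

Lemma quot_form_homog d p : p \is d.-homog -> quot_form A p \is d.-homog.
Proof.
move=> /dhomogP pd; rewrite /quot_form comp_mpolyEX big_seq.
apply: rpred_sum => m /pd <-; apply: rpredZ; rewrite /= mdegE.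
rewrite comp_mpolyX.
apply: (big_ind2 (fun (q : {mpoly K[k]}) (e : nat) => q \is e.-homog))
  => [||r _].
- exact: dhomog1.
- by move=> p1 d1 p2 d2; apply: dhomogM.
rewrite tnth_mktuple -[X in X.-homog]mul1n; apply: dhomogMn.
by apply: rpred_sum => s _; apply: rpredZ; rewrite dhomogX /= mdeg1.
Qed.

(** The section of [quot_form] sending the new variables to the linear forms
    that they stand for: ['Y_s] is given by column [s] of [A^-1]. *)
Definition quot_form_section (p : {mpoly K[k]}) : R :=
  p \mPo [tuple lform (col (lift ord_max s) (invmx A)) | s < k].

HB.instance Definition _ := GRing.RMorphism.copy quot_form_section
  (comp_mpoly [tuple lform (col (lift ord_max s) (invmx A)) | s < k]).

Hypothesis uA : A \in unitmx.

Lemma quot_form_sectionX s :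
  quot_form_section 'X_s = lform (col (lift ord_max s) (invmx A)).
Proof. by rewrite /quot_form_section comp_mpolyXU -tnth_nth tnth_mktuple. Qed.

Lemma quot_form_sectionZ c p :
  quot_form_section (c *: p) = c *: quot_form_section p.
Proof. exact: comp_mpolyZ. Qed.

Lemma quot_formC c : quot_form A c%:MP = c%:MP.
Proof. exact: comp_mpolyC. Qed.

Lemma quot_form_sectionC c : quot_form_section c%:MP = c%:MP.
Proof. exact: comp_mpolyC. Qed.

Lemma quot_form_sectionK : cancel quot_form_section (quot_form A).
Proof.
have KX s : quot_form A (quot_form_section 'X_s) = 'X_s.
  rewrite quot_form_sectionX -forms_lform quot_form_forms mulmxV //.
  rewrite (bigD1 s) //= mxE eqxx scale1r big1 ?addr0 // => t ts.
  by rewrite mxE (inj_eq lift_inj) (negPf ts) scale0r.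
move=> p; rewrite [p]mpolyE (rmorph_sum quot_form_section).
rewrite (rmorph_sum (quot_form A)); apply: eq_bigr => m _.
rewrite -mul_mpolyC !rmorphM /= quot_form_sectionC quot_formC; congr (_ * _).
rewrite mpolyXE_id !(rmorph_prod, rmorph_prod (quot_form A)) /=.
apply: eq_bigr => s _.
by rewrite !rmorphXn /= KX.
Qed.

Hypothesis colA : col i (A *m G) = delta_mx ord_max 0.

(** Composing with the section moves ['X_r] by [A ord_max r] times the last
    coordinate ['Y_ord_max], which is the [i]-th form, so it moves every
    polynomial by a multiple of that form. *)
Lemma quot_form_ker p : quot_form A p = 0 -> exists q, p = forms G i * q.
Proof.
move=> p0; suff [q pq] : lin_ideal [:: col i G] p.
  by exists q; apply/eqP; rewrite forms_lform -subr_eq0; apply/eqP.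
rewrite -[p]subr0 -(rmorph0 quot_form_section) -p0.
apply: (lin_ideal_subst (f := quot_form_section \o quot_form A)) => [c|r] /=.
  by rewrite quot_formC quot_form_sectionC.
exists (A ord_max r)%:MP; apply/eqP; rewrite subr_eq0 mulrC mul_mpolyC.
rewrite subr_eq addrC; apply/eqP.
have GE : col i G = col ord_max (invmx A).
  by rewrite [RHS]colE -colA colE -mulmxA mulKmx // -colE.
(* The identity [A^-1 * A = 1], read on its column [r]. *)
have rE : delta_mx r 0 = \sum_s A s r *: col s (invmx A).
  apply/colP => t; rewrite summxE -[LHS]/((delta_mx r 0 : 'cV_k.+1) t 0) mxE.
  have := congr1 (fun B : 'M_k.+1 => B t r) (mulVmx uA).
  rewrite !mxE andbT => <-; apply: eq_bigr => s _.
  by rewrite !mxE mulrC.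
have XE : quot_form_section (quot_form A 'X_r) =
    \sum_s A (lift ord_max s) r *: lform (col (lift ord_max s) (invmx A)).
  rewrite /quot_form comp_mpolyXU -tnth_nth tnth_mktuple rmorph_sum.
  by apply: eq_bigr => s _; rewrite /= quot_form_sectionZ quot_form_sectionX.
rewrite XE GE -lform_delta rE linear_sum (bigD1_ord ord_max) //= linearZ.
by rewrite addrC; congr (_ + _); apply: eq_bigr => s _; rewrite linearZ.
Qed.

Lemma quot_form_ideal_lift j b :
  b \in fitt_ideal (forms (restriction (A *m G) i)) j ->
  exists2 a, a \in fitt_ideal (forms (deletion G i)) j & quot_form A a = b.
Proof.
move=> /boolp.asboolP[c ->].
apply: (big_ind (fun b => exists2 a,
   a \in fitt_ideal (forms (deletion G i)) j & quot_form A a = b)).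
- by exists 0; rewrite ?fitt_ideal_zero ?rmorph0.
- move=> _ _ [a aI <-] [a' aI' <-]; exists (a + a'); last exact: rmorphD.
  exact: fitt_idealD.
move=> S /eqP Sj.
exists (quot_form_section (c S) * \prod_(s in S) forms (deletion G i) s).
  exact: fitt_ideal_gen.
rewrite rmorphM rmorph_prod /= quot_form_sectionK; congr (_ * _).
by apply: eq_bigr => s _; rewrite forms_deletion quot_form_forms_lift.
Qed.

Lemma fitt_ideal_deletion_sub j p :
  p \in fitt_ideal (forms (deletion G i)) j -> p \in fitt_ideal (forms G) j.
Proof.
case: j => [|j] pI; first exact: fitt_ideal0.
apply/fitt_ideal_deletionP; exists 0, p.
by rewrite fitt_ideal_zero mulr0 add0r.
Qed.

End DeletionRestriction.

(** * The short exact sequence *)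

Section ShortExact.
Variables (K : fieldType) (k n : nat).
Variables (G : 'M[K]_(k.+1, n.+1)) (i : 'I_n.+1).

Lemma subquot_class_eq0 (R : comNzRingType) (V : lmodType R)
    (U W : submodClosed V) (u : submod U) :
  subquot_class W u = 0 <-> \val u \in W.
Proof.
rewrite -(raddf0 (subquot_class W)) subquot_classE.
by rewrite -[X in X \in W]raddfB subr0.
Qed.

(** Computes [mul_form] on classes, with [j + 1] presented as [lift ord0 j];
    the target representative is a parameter because its type depends on
    that presentation. *)
Lemma mul_form_lift (x : Fitt (forms (deletion G i))) (j : 'I_n.+1)
    (u : submod (fitt_ideal (forms (deletion G i)) j))
    (v : submod (fitt_ideal (forms G) (lift ord0 j))) :
  x j = subquot_class _ u -> \val v = forms G i * \val u ->
  mul_form G i x (lift ord0 j) = subquot_class _ v.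
Proof.
move=> xj vE; rewrite /mul_form liftK xj.
apply: subquot_mapE => [p q|p|p|//].
- exact: mulrBr.
- exact: mul_form_ideal.
- exact: mul_form_ideal.
Qed.

Lemma mul_form0 (x : Fitt (forms (deletion G i))) : mul_form G i x ord0 = 0.
Proof. by rewrite /mul_form unlift_none. Qed.

Lemma mul_form_inj : MDS G -> injective (mul_form G i).
Proof.
move=> hG; apply: raddf_inj => x x0.
apply: boolp.functional_extensionality_dep => j.
have [u xj] := subquot_surj (x j); rewrite xj; apply/subquot_class_eq0.
pose v : submod (fitt_ideal (forms G) (lift ord0 j)) :=
  Submod (mul_form_ideal (valP u)).
have := mul_form_lift xj (erefl (\val v)).
rewrite x0 => /esym /subquot_class_eq0.
move/(fitt_ideal_deletionP G i) => [a [b [aI bI /= E]]].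
have : \val u - a \in fitt_ideal (forms (deletion G i)) j.+1.
  apply: fitt_ideal_deletion_colon => //.
  by rewrite mulrBr E addrC addKr.
by move=> uaI; rewrite -[\val u](subrK a); apply: fitt_idealD.
Qed.

Variable A : 'M[K]_k.+1.
Hypothesis uA : A \in unitmx.
Hypothesis colA : col i (A *m G) = delta_mx ord_max 0.

Lemma restriction_mapE (x : Fitt (forms G)) (j : 'I_n.+1)
    (u : submod (fitt_ideal (forms G) (widen_ord (leqnSn _) j)))
    (v : submod (fitt_ideal (forms (restriction (A *m G) i)) j)) :
  x (widen_ord (leqnSn _) j) = subquot_class _ u ->
  \val v = quot_form A (\val u) ->
  restriction_map colA x j = subquot_class _ v.
Proof.
move=> xj vE; rewrite /restriction_map xj.
apply: subquot_mapE => [p q|p|p|//].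
- exact: rmorphB.
- exact: quot_form_ideal.
- exact: quot_form_ideal.
Qed.

(** The component indexed by [n + 1] has no counterpart in the target and can
    be chosen to be [0]. *)
Lemma restriction_map_surj z : exists x, z = restriction_map colA x.
Proof.
have [j|u uP] := @fin_all_exists _
  (fun j : 'I_n.+2 => submod (fitt_ideal (forms G) j))
  (fun j u => forall j' : 'I_n.+1, j = widen_ord (leqnSn _) j' ->
     exists2 v, z j' = subquot_class _ v & \val v = quot_form A (\val u)).
  have [jn|nj] := ltnP j n.+1; last first.
    by exists 0 => j' jE; move: nj; rewrite jE /= leqNgt ltn_ord.
  pose j1 := Ordinal jn; have [v zv] := subquot_surj (z j1).
  have [a /fitt_ideal_deletion_sub aI av] := quot_form_ideal_lift uA (valP v).
  exists (Submod aI) => j' jE; have <- : j1 = j' by apply: val_inj; rewrite /= jE.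
  by exists v.
exists (fun j => subquot_class _ (u j)).
apply: boolp.functional_extensionality_dep => j.
have [v -> vE] := uP _ j erefl.
by symmetry; apply: restriction_mapE vE.
Qed.

Lemma restriction_map_mul_form y : restriction_map colA (mul_form G i y) = 0.
Proof.
have mul_class j : exists2 w,
    mul_form G i y j = subquot_class _ w & quot_form A (\val w) = 0.
  case: (unliftP ord0 j) => [j' ->|->]; last first.
    by exists 0; rewrite ?mul_form0 ?raddf0 //; apply: (raddf0 (quot_form A)).
  have [u yu] := subquot_surj (y j').
  pose v : submod (fitt_ideal (forms G) (lift ord0 j')) :=
    Submod (mul_form_ideal (valP u)).
  exists v; first exact: mul_form_lift yu _.
  by rewrite rmorphM /= (quot_form_form colA) mul0r.
apply: boolp.functional_extensionality_dep => j.
have [w yw w0] := mul_class (widen_ord (leqnSn _) j).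
by rewrite (restriction_mapE (v := 0) yw) ?w0 ?raddf0.
Qed.

(** The representative [w] of a component is corrected by a lift [c] of its
    image in the smaller ideal; what remains is a multiple [l * r] of the
    form, and the colon property puts [r] in the right ideal. *)
Lemma restriction_map_ker x : MDS G ->
  restriction_map colA x = 0 -> exists y, x = mul_form G i y.
Proof.
move=> hG x0.
have quot0 (j : 'I_n.+2) w : (j < n.+1)%N -> x j = subquot_class _ w ->
    quot_form A (\val w) \in fitt_ideal (forms (restriction (A *m G) i)) j.+1.
  move=> jn; have [j' jE] : exists j' : 'I_n.+1, j = widen_ord (leqnSn _) j'.
    by exists (Ordinal jn); apply: val_inj.
  subst j => xw.
  pose v : submod (fitt_ideal (forms (restriction (A *m G) i)) j') :=
    Submod (quot_form_ideal colA (valP w)).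
  have := restriction_mapE (v := v) xw erefl.
  by rewrite x0 => /esym /subquot_class_eq0.
have [j|u uP] := @fin_all_exists _
  (fun j : 'I_n.+1 => submod (fitt_ideal (forms (deletion G i)) j))
  (fun j u => exists2 v, x (lift ord0 j) = subquot_class _ v
                       & \val v = forms G i * \val u).
  have [w xw] := subquot_surj (x (lift ord0 j)).
  have /(fitt_ideal_deletionP G i)[a [b [aI bI wE]]] := valP w.
  (* On the last component the restriction says nothing, but there are not
     enough other forms for a product avoiding the [i]-th. *)
  have [jn|nj] := ltnP j n; last first.
    exists (Submod aI); exists w => //.
    by rewrite wE (fitt_ideal_gt _ bI) ?addr0.
  have [c cI cw] := quot_form_ideal_lift uA (quot0 (lift ord0 j) _ jn xw).
  have [r wr] : exists r, \val w - c = forms G i * r.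
    by apply: (quot_form_ker uA colA); rewrite rmorphB /= cw subrr.
  have rI : r \in fitt_ideal (forms (deletion G i)) j.
    rewrite -[r](subrK a); apply: fitt_idealD => //.
    apply: fitt_ideal_deletion_colon => //.
    have -> : forms G i * (r - a) = b - c by rewrite mulrBr -wr wE; ring.
    exact: fitt_idealB bI (fitt_ideal_sub cI).
  exists (Submod rI).
  pose v : submod (fitt_ideal (forms G) (lift ord0 j)) :=
    Submod (mul_form_ideal rI).
  exists v => //; rewrite xw; apply/subquot_classE => /=.
  rewrite -wr opprB addrC subrK.
  exact: fitt_ideal_deletion_sub cI.
exists (fun j => subquot_class _ (u j)).
apply: boolp.functional_extensionality_dep => j.
case: (unliftP ord0 j) => [j' ->|->].
  by have [v -> vE] := uP j'; symmetry; apply: mul_form_lift vE.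
(* On the component of index [0] the form itself lies in the smaller ideal, so
   that the kernel of the restriction is trivial there. *)
rewrite mul_form0; have [w xw] := subquot_surj (x ord0); rewrite xw.
apply/subquot_class_eq0.
have [c cI cw] := quot_form_ideal_lift uA (quot0 ord0 _ isT xw).
have [r wr] : exists r, \val w - c = forms G i * r.
  by apply: (quot_form_ker uA colA); rewrite rmorphB /= cw subrr.
apply/(fitt_ideal_deletionP G i); exists r, c; split=> //; first exact: fitt_ideal0.
by rewrite -wr subrK.
Qed.

Lemma mul_form_graded :
  graded_map (shift (-1) (Fitt_piece (forms (deletion G i))))
             (Fitt_piece (forms G)) (mul_form G i).
Proof.
move=> t x xt j; case: (unliftP ord0 j) => [j' ->|->]; last first.
  exists 0; rewrite ?mul_form0 ?raddf0 //=.
  by case: t {xt} => d /=; rewrite ?dhomog0.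
have [u uh xu] := xt j'.
exists (Submod (mul_form_ideal (valP u))); last exact: mul_form_lift xu _.
rewrite /=; case: t uh {xt} => [[|d]|d] /=.
(* For [t = 0] the source piece has degree [-1] and is zero. *)
- by move/eqP->; rewrite mulr0 dhomog0.
- by rewrite subn1 /= => uh; rewrite -[d.+1]add1n forms_lform dhomogM ?lform_homog.
- by move/eqP->; rewrite mulr0.
Qed.

Lemma restriction_map_graded :
  graded_map (Fitt_piece (forms G))
             (Fitt_piece (forms (restriction (A *m G) i)))
             (restriction_map colA).
Proof.
move=> t x xt j; have [u uh xu] := xt (widen_ord (leqnSn _) j).
exists (Submod (quot_form_ideal colA (valP u))); last exact: restriction_mapE xu _.
case: t uh {xt} => d /=; first exact: quot_form_homog.
by move/eqP->; rewrite raddf0.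
Qed.

End ShortExact.

Theorem theorem2p5 (K : fieldType) (k n : nat)
    (G : 'M[K]_(k.+1, n.+1)) (hG : MDS G) (i : 'I_n.+1)
    (A : 'M[K]_k.+1) (uA : A \in unitmx)
    (colA : col i (A *m G) = delta_mx ord_max 0) :
  [/\ short_exact (mul_form G i) (restriction_map colA),
      graded_map (shift (-1) (Fitt_piece (forms (deletion G i))))
                 (Fitt_piece (forms G)) (mul_form G i)
    & graded_map (Fitt_piece (forms G))
                 (Fitt_piece (forms (restriction (A *m G) i)))
                 (restriction_map colA)].
Proof.
split; [|exact: mul_form_graded|exact: restriction_map_graded].
split; first exact: mul_form_inj.
  move=> x; split=> [|[y ->]]; first exact: restriction_map_ker.
  exact: restriction_map_mul_form.
exact: restriction_map_surj.
Qed.
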